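(* For each of the following families $F_{\mathbf c,\mathbf s}:\mathbb{R}^2\to\mathbb{R}$ (real parameters $\mathbf c$, $\mathbf s=(s_1,s_2)\in\mathbb{R}^2$, any fixed choice of the signs $\pm$), with associated integer $n$: $A_n$ ($n\ge2$): $F=\pm x_1^{n+1}\pm x_2^2+c_{n-1}x_1^{n-1}+\cdots+c_3x_1^3+s_2x_1^2-s_1x_1\pm s_2x_2$; $D_n$ ($n\ge4$): $F=x_1^2x_2\pm x_2^{n-1}+c_{n-2}x_2^{n-2}+\cdots+c_2x_2^2-s_2x_2-s_1x_1$; $E_6$ ($n=6$): $F=x_1^3\pm x_2^4+c_3x_1x_2^2+c_2x_2^2+c_1x_1x_2-s_2x_2-s_1x_1$; $E_7$ ($n=7$): $F=x_1^3+x_1x_2^3+c_4x_2^4+c_3x_2^3+c_2x_2^2+c_1x_1x_2-s_2x_2-s_1x_1$; $E_8$ ($n=8$): $F=x_1^3+x_2^5+c_5x_1x_2^3+c_4x_1x_2^2+c_3x_2^3+c_2x_2^2+c_1x_1x_2-s_2x_2-s_1x_1$; the following holds: if, for given parameter values, $F_{\mathbf c,\mathbf s}$ has exactly $n$ real critical points $\mathbf x_1,\dots,\mathbf x_n$ and each is nondegenerate ($\det[\mathrm{Hess}\,F_{\mathbf c,\mathbf s}](\mathbf x_i)\ne0$), then $\sum_{i=1}^n\mathfrak M_i=0$, where $\mathfrak M_i=1/\det[\mathrm{Hess}\,F_{\mathbf c,\mathbf s}](\mathbf x_i)$.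
   Context: These are Arnold's normal forms of generating families for the $A,D,E$ classification of stable simple Lagrangian map-germs. Critical points of $F_{\mathbf c,\mathbf s}$ (gradient in $\mathbf x=(x_1,x_2)$) are the lensed images of the source $\mathbf s$, and $\mathfrak M_i$, the reciprocal of the Gaussian curvature $\det[\mathrm{Hess}\,F_{\mathbf c,\mathbf s}]$ of the graph at the critical point, is the signed magnification. The set of such $\mathbf s$ (for fixed $\mathbf c$) is the $n$-image region. *)

(* Defs.v *)
From Stdlib Require Import Reals List.
Import ListNotations.
Open Scope R_scope.

Definition sgn (b : bool) : R := if b then 1 else -1.

Definition sumR (a len : nat) (f : nat -> R) : R :=
  fold_right Rplus 0 (map f (seq a len)).

Definition is_d1 (F G : R -> R -> R) : Prop :=
  forall x y, derivable_pt_lim (fun t => F t y) x (G x y).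
Definition is_d2 (F G : R -> R -> R) : Prop :=
  forall x y, derivable_pt_lim (fun t => F x t) y (G x y).

Definition critical (F : R -> R -> R) (p : R * R) : Prop :=
  derivable_pt_lim (fun t => F t (snd p)) (fst p) 0 /\
  derivable_pt_lim (fun t => F (fst p) t) (snd p) 0.

Definition hess_det (F : R -> R -> R) (p : R * R) (h : R) : Prop :=
  exists G1 G2 G11 G12 G21 G22 : R -> R -> R,
    is_d1 F G1 /\ is_d2 F G2 /\
    is_d1 G1 G11 /\ is_d2 G1 G12 /\ is_d1 G2 G21 /\ is_d2 G2 G22 /\
    h = G11 (fst p) (snd p) * G22 (fst p) (snd p)
        - G12 (fst p) (snd p) * G21 (fst p) (snd p).

Definition magnification_sum_zero (F : R -> R -> R) (n : nat) : Prop :=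
  forall (pts : list (R * R)) (h : R * R -> R),
    length pts = n -> NoDup pts ->
    (forall p, critical F p <-> In p pts) ->
    (forall p, In p pts -> hess_det F p (h p) /\ h p <> 0) ->
    fold_right Rplus 0 (map (fun p => / h p) pts) = 0.

Definition F_A (n : nat) (e1 e2 e3 : bool) (c : nat -> R) (s1 s2 : R)
  (x1 x2 : R) : R :=
  sgn e1 * x1 ^ (n + 1) + sgn e2 * x2 ^ 2
  + sumR 3 (n - 3) (fun k => c k * x1 ^ k)
  + s2 * x1 ^ 2 - s1 * x1 + sgn e3 * s2 * x2.

Definition F_D (n : nat) (e : bool) (c : nat -> R) (s1 s2 : R)
  (x1 x2 : R) : R :=
  x1 ^ 2 * x2 + sgn e * x2 ^ (n - 1)
  + sumR 2 (n - 3) (fun k => c k * x2 ^ k)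
  - s2 * x2 - s1 * x1.

Definition F_E6 (e : bool) (c1 c2 c3 s1 s2 : R) (x1 x2 : R) : R :=
  x1 ^ 3 + sgn e * x2 ^ 4 + c3 * x1 * x2 ^ 2 + c2 * x2 ^ 2 + c1 * x1 * x2
  - s2 * x2 - s1 * x1.

Definition F_E7 (c1 c2 c3 c4 s1 s2 : R) (x1 x2 : R) : R :=
  x1 ^ 3 + x1 * x2 ^ 3 + c4 * x2 ^ 4 + c3 * x2 ^ 3 + c2 * x2 ^ 2
  + c1 * x1 * x2 - s2 * x2 - s1 * x1.

Definition F_E8 (c1 c2 c3 c4 c5 s1 s2 : R) (x1 x2 : R) : R :=
  x1 ^ 3 + x2 ^ 5 + c5 * x1 * x2 ^ 3 + c4 * x1 * x2 ^ 2 + c3 * x2 ^ 3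
  + c2 * x2 ^ 2 + c1 * x1 * x2 - s2 * x2 - s1 * x1.

(* Main.v *)
(** Write the differences of the gradient as [P(p) - P(q) = A(p,q) (p - q)] with a
    polynomial 2x2 matrix [A], and let [B(p,q) = det A(p,q)] be the Bezoutian. It
    vanishes at two distinct critical points, since [p - q] is then a nonzero kernel
    vector, and it is the Hessian determinant when [p = q]. In each family [B(p,q)],
    reduced modulo the gradient at [q], is a sum over [b < n] of [h_b(p) m_b(q)] with [n]
    monomials [m_b]. At [n] critical points this says that the square matrices
    [h_b(p_i) / det Hess(p_i)] and [m_b(p_j)] are inverse to each other up to
    transposition. Multiplying them in the other order, the entry pairing the monomial
    [1] with the monomial of top weight, whose coefficient [h] is a nonzero constant,
    says that the sum of the [1 / det Hess(p_i)] is zero. *)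
Require Import Defs.
From Stdlib Require Import Reals List.
From Stdlib Require Import Lia Lra.
From Coquelicot Require Import Coquelicot.
From mathcomp Require all_boot all_algebra Rstruct.
Import ListNotations.
Open Scope R_scope.

(** * Finite sums over integer ranges *)

Lemma sumR_ext (a len : nat) (f g : nat -> R) :
  (forall i, (a <= i < a + len)%nat -> f i = g i) -> sumR a len f = sumR a len g.
Proof.
  revert a. induction len as [|len IH]; intros a H; [reflexivity|].
  change (f a + sumR (S a) len f = g a + sumR (S a) len g).
  rewrite (H a) by lia. f_equal. apply IH. intros; apply H; lia.
Qed.

Lemma sumR_split (a l1 l2 : nat) (f : nat -> R) :
  sumR a (l1 + l2) f = sumR a l1 f + sumR (a + l1) l2 f.
Proof.
  revert a. induction l1 as [|l1 IH]; intros a.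
  - rewrite Nat.add_0_r. unfold sumR at 2. simpl. lra.
  - change (f a + sumR (S a) (l1 + l2) f
            = f a + sumR (S a) l1 f + sumR (a + S l1) l2 f).
    rewrite IH, Nat.add_succ_comm. lra.
Qed.

Lemma sumR_recr (a len : nat) (f : nat -> R) :
  sumR a (S len) f = sumR a len f + f (a + len)%nat.
Proof.
  replace (S len) with (len + 1)%nat by lia. rewrite sumR_split.
  unfold sumR at 2. simpl. lra.
Qed.

Lemma sumR_shift (a len : nat) (f : nat -> R) :
  sumR (S a) len f = sumR a len (fun i => f (S i)).
Proof. unfold sumR. now rewrite <- seq_shift, map_map. Qed.

Lemma sumR_recl (len : nat) (f : nat -> R) :
  sumR 0 (S len) f = f 0%nat + sumR 0 len (fun i => f (S i)).
Proof. now rewrite <- sumR_shift. Qed.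

Lemma sumR_plus (a len : nat) (f g : nat -> R) :
  sumR a len (fun i => f i + g i) = sumR a len f + sumR a len g.
Proof.
  induction len as [|len IH]; [unfold sumR; simpl; lra|].
  rewrite !sumR_recr, IH. lra.
Qed.

Lemma sumR_scal (a len : nat) (r : R) (f : nat -> R) :
  sumR a len (fun i => r * f i) = r * sumR a len f.
Proof.
  induction len as [|len IH]; [unfold sumR; simpl; lra|].
  rewrite !sumR_recr, IH. lra.
Qed.

Lemma fold_right_sumR (T : Type) (d : T) (g : T -> R) (s : list T) :
  fold_right Rplus 0 (map g s) = sumR 0 (length s) (fun i => g (nth i s d)).
Proof.
  induction s as [|x s IH]; [reflexivity|].
  cbn [length]. rewrite sumR_recl. simpl. now rewrite IH.
Qed.

(** * Reversing the order in a matrix product equal to the identity *)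

Section DualBases.
Import mathcomp.boot.all_boot mathcomp.algebra.all_algebra.
Import mathcomp.reals_stdlib.Rstruct.
Import GRing.Theory.

Lemma sumR_bigop (n : nat) (f : nat -> R) : sumR 0 n f = (\sum_(i < n) f i)%R.
Proof.
elim: n => [|n IH]; first by rewrite big_ord0.
by rewrite sumR_recr big_ord_recr /= IH.
Qed.

(** With [H] and [M] read as square matrices, the hypothesis is that the product of [H] with the
    transpose of [M] is the identity. A one-sided inverse of a square matrix is two-sided
    ([mulmx1C]), so the factors may be exchanged. *)
Lemma sumR_dual_bases (n : nat) (H M : nat -> nat -> R) :
  (forall i j, (i < n)%coq_nat -> (j < n)%coq_nat ->
     sumR 0 n (fun b => H i b * M j b) = if Nat.eqb i j then 1 else 0) ->
  forall k l, (k < n)%coq_nat -> (l < n)%coq_nat ->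
     sumR 0 n (fun i => M i k * H i l) = if Nat.eqb k l then 1 else 0.
Proof.
move=> HM k l /ltP ltkn /ltP ltln.
pose A := (\matrix_(i < n, b < n) H i b : 'M[R]_n)%R.
pose B := (\matrix_(b < n, j < n) M j b : 'M[R]_n)%R.
have eqbE (i j : 'I_n) : (if Nat.eqb i j then 1 else 0) = ((i == j)%:R : R)%R.
  by case: Nat.eqb_spec => [/val_inj ->|/eqP/negPf ne]; rewrite ?eqxx // -val_eqE ne.
have AB : (A *m B = 1%:M)%R.
  apply/matrixP => i j; rewrite mxE [RHS]mxE -eqbE.
  rewrite -(HM i j (elimT ltP (ltn_ord i)) (elimT ltP (ltn_ord j))) sumR_bigop.
  by apply: eq_bigr => b _; rewrite !mxE.
have /matrixP/(_ (Ordinal ltkn) (Ordinal ltln)) := mulmx1C AB.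
rewrite mxE [RHS]mxE -eqbE /= => <-; rewrite sumR_bigop.
by apply: eq_bigr => b _; rewrite !mxE.
Qed.
End DualBases.

(** * Uniqueness of partial derivatives and of the Hessian determinant *)

Lemma is_d1_unique (F F' G G' : R -> R -> R) :
  (forall x y, F x y = F' x y) -> is_d1 F G -> is_d1 F' G' ->
  forall x y, G x y = G' x y.
Proof.
  intros E H H' x y. eapply uniqueness_limite; [|apply H'].
  apply is_derive_Reals, (is_derive_ext (fun t => F t y));
    [intros; apply E | apply is_derive_Reals, H].
Qed.

Lemma is_d2_unique (F F' G G' : R -> R -> R) :
  (forall x y, F x y = F' x y) -> is_d2 F G -> is_d2 F' G' ->
  forall x y, G x y = G' x y.
Proof.
  intros E H H' x y. eapply uniqueness_limite; [|apply H'].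
  apply is_derive_Reals, (is_derive_ext (fun t => F x t));
    [intros; apply E | apply is_derive_Reals, H].
Qed.

(** [hess_det] quantifies existentially over the derivatives; uniqueness of limits lets explicit
    derivatives replace the unknown witnesses, first at order one and then at order two. *)
Lemma hess_det_unique (F P1 P2 P11 P12 P21 P22 : R -> R -> R) (p : R * R) (h : R) :
  is_d1 F P1 -> is_d2 F P2 ->
  is_d1 P1 P11 -> is_d2 P1 P12 -> is_d1 P2 P21 -> is_d2 P2 P22 ->
  hess_det F p h ->
  h = P11 (fst p) (snd p) * P22 (fst p) (snd p)
      - P12 (fst p) (snd p) * P21 (fst p) (snd p).
Proof.
  intros H1 H2 H11 H12 H21 H22
    (G1 & G2 & G11 & G12 & G21 & G22 & K1 & K2 & K11 & K12 & K21 & K22 & ->).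
  assert (E1 := is_d1_unique F F G1 P1 (fun _ _ => eq_refl) K1 H1).
  assert (E2 := is_d2_unique F F G2 P2 (fun _ _ => eq_refl) K2 H2).
  rewrite (is_d1_unique _ _ _ _ E1 K11 H11), (is_d2_unique _ _ _ _ E1 K12 H12),
    (is_d1_unique _ _ _ _ E2 K21 H21), (is_d2_unique _ _ _ _ E2 K22 H22).
  reflexivity.
Qed.

(** * The Bezoutian criterion *)

Lemma det2_eq_zero (a b c d w z : R) :
  a * w + b * z = 0 -> c * w + d * z = 0 -> w <> 0 \/ z <> 0 ->
  a * d - b * c = 0.
Proof.
  intros H1 H2 [Hw|Hz].
  - apply (Rmult_eq_reg_r w); [|exact Hw].
    replace ((a * d - b * c) * w) with (d * (a * w + b * z) - b * (c * w + d * z)) by ring.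
    rewrite H1, H2; ring.
  - apply (Rmult_eq_reg_r z); [|exact Hz].
    replace ((a * d - b * c) * z) with (a * (c * w + d * z) - c * (a * w + b * z)) by ring.
    rewrite H1, H2; ring.
Qed.

(** Reduces each family to an explicit certificate: a matrix [a11], [a12], [a21], [a22] of
    difference quotients of the gradient that restricts to the Hessian on the diagonal, and a
    splitting of its determinant valid when [(u,v)] is critical. Index [k] marks the monomial 1, and
    [l] the top monomial with constant coefficient [beta]. *)
Lemma bezoutian_magnification_sum_zero
  (n k l : nat) (beta : R) (F P1 P2 : R -> R -> R)
  (a11 a12 a21 a22 : R -> R -> R -> R -> R) (h m : nat -> R -> R -> R) :
  is_d1 F P1 -> is_d2 F P2 ->
  is_d1 P1 (fun x y => a11 x y x y) -> is_d2 P1 (fun x y => a12 x y x y) ->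
  is_d1 P2 (fun x y => a21 x y x y) -> is_d2 P2 (fun x y => a22 x y x y) ->
  (forall x y u v, P1 x y - P1 u v = a11 x y u v * (x - u) + a12 x y u v * (y - v)) ->
  (forall x y u v, P2 x y - P2 u v = a21 x y u v * (x - u) + a22 x y u v * (y - v)) ->
  (forall x y u v, P1 u v = 0 -> P2 u v = 0 ->
     a11 x y u v * a22 x y u v - a12 x y u v * a21 x y u v
     = sumR 0 n (fun b => h b x y * m b u v)) ->
  (k < n)%nat -> (l < n)%nat -> k <> l ->
  (forall x y, m k x y = 1) -> (forall x y, h l x y = beta) -> beta <> 0 ->
  magnification_sum_zero F n.
Proof.
  intros H1 H2 H11 H12 H21 H22 D1 D2 B Hk Hl Hkl Hm Hh Hbeta pts J Hlen Hnd Hcrit HJ.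
  assert (Z : forall p, In p pts -> P1 (fst p) (snd p) = 0 /\ P2 (fst p) (snd p) = 0).
  { intros p Hp. apply Hcrit in Hp as [C1 C2].
    split; eapply uniqueness_limite; [apply H1|exact C1|apply H2|exact C2]. }
  set (P := fun i => nth i pts (0, 0)).
  assert (HP : forall i, (i < n)%nat -> In (P i) pts) by (intros; apply nth_In; lia).
  (* The factor [/ J (P i)] normalises the diagonal pairings to 1. *)
  set (H' := fun i b => / J (P i) * h b (fst (P i)) (snd (P i))).
  set (M' := fun i b => m b (fst (P i)) (snd (P i))).
  assert (HM : forall i j, (i < n)%nat -> (j < n)%nat ->
     sumR 0 n (fun b => H' i b * M' j b) = if Nat.eqb i j then 1 else 0).
  { intros i j Hi Hj.
    destruct (Z _ (HP i Hi)) as [Zi1 Zi2], (Z _ (HP j Hj)) as [Zj1 Zj2].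
    destruct (HJ _ (HP i Hi)) as [HJi HJ0].
    rewrite (sumR_ext _ _ _ (fun b => / J (P i) *
      (h b (fst (P i)) (snd (P i)) * m b (fst (P j)) (snd (P j)))))
      by (intros; unfold H', M'; ring).
    rewrite sumR_scal, <- (B _ _ _ _ Zj1 Zj2).
    destruct (Nat.eqb_spec i j) as [<-|Hij].
    - rewrite <- (hess_det_unique F _ _ _ _ _ _ (P i) (J (P i)) H1 H2 H11 H12 H21 H22 HJi).
      now apply Rinv_l.
    (* Both gradients vanish, so the difference of the two distinct points is a nonzero kernel
       vector of the difference matrix. *)
    - rewrite (det2_eq_zero _ _ _ _ (fst (P i) - fst (P j)) (snd (P i) - snd (P j)));
        [ring|rewrite <- D1; lra|rewrite <- D2; lra|].
      destruct (Req_dec (fst (P i)) (fst (P j))) as [E1|E1]; [right|left; lra].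
      intros E2. apply Hij. apply (proj1 (NoDup_nth pts (0, 0)) Hnd); [lia|lia|].
      apply injective_projections; fold (P i) (P j); lra. }
  (* Since [k <> l], the reversed pairing is 0, and its terms are [1 * (beta / J (P i))]. *)
  assert (S := sumR_dual_bases n H' M' HM k l Hk Hl).
  apply Nat.eqb_neq in Hkl. rewrite Hkl in S.
  rewrite (sumR_ext _ _ _ (fun i => beta * / J (P i))), sumR_scal in S
    by (intros; unfold H', M'; rewrite Hm, Hh; ring).
  rewrite (fold_right_sumR _ (0, 0)), Hlen.
  now apply Rmult_integral in S as [S|S].
Qed.

(** * The families E6, E7 and E8 *)

Ltac solve_partial :=
  intros x y; apply is_derive_Reals; auto_derive; [exact I | ring].

(** [u^2] is eliminated through the first partial derivative at [(u,v)]. *)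
Lemma magnification_sum_zero_E6 (e : bool) (c1 c2 c3 s1 s2 : R) :
  magnification_sum_zero (F_E6 e c1 c2 c3 s1 s2) 6.
Proof.
  (* Index 5 is the monomial [u * v ^ 2]; its coefficient comes from [3 * u] times
     [4 * sgn e * v ^ 2] in the product of the diagonal entries. *)
  apply (bezoutian_magnification_sum_zero 6 0 5 (12 * sgn e) _
    (fun x y => 3 * x ^ 2 + c3 * y ^ 2 + c1 * y - s1)
    (fun x y => 4 * sgn e * y ^ 3 + 2 * c3 * x * y + 2 * c2 * y + c1 * x - s2)
    (fun x y u v => 3 * (x + u))
    (fun x y u v => c3 * (y + v) + c1)
    (* The mixed term is split by [x * y - u * v = y * (x - u) + u * (y - v)]. *)
    (fun x y u v => 2 * c3 * y + c1)
    (fun x y u v => 4 * sgn e * (y ^ 2 + y * v + v ^ 2) + 2 * c3 * u + 2 * c2)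
    (fun b x y => nth b
      [3 * x * (4 * sgn e * y ^ 2 + 2 * c2) + 2 * c3 * s1
         - (c3 * y + c1) * (2 * c3 * y + c1);
       12 * sgn e * x * y - 2 * c3 * c1 - c3 * (2 * c3 * y + c1);
       12 * sgn e * x - 2 * c3 ^ 2;
       3 * (4 * sgn e * y ^ 2 + 2 * c2) + 6 * c3 * x;
       12 * sgn e * y;
       12 * sgn e] 0)
    (fun b u v => nth b [1; v; v ^ 2; u; u * v; u * v ^ 2] 0));
    unfold F_E6; try solve_partial; try lia; try reflexivity.
  - intros; ring.
  - intros; ring.
  - intros x y u v E1 E2. unfold sumR. cbn [seq map fold_right nth].
    (* The vanishing gradient at [(u,v)] is imposed by solving for the parameter [s1], in which it
       is linear; what remains is a plain polynomial identity. E7 and E8 treat [s1] and [s2] in the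
       same way. *)
    replace s1 with (3 * u ^ 2 + c3 * v ^ 2 + c1 * v) by lra. ring.
  - destruct e; simpl; lra.
Qed.

(** [u^2 v] is eliminated through the first partial derivative, [u v^2] through the second;
    the top monomial [v^4] comes from [9 u^2 v = -3 v^4 + ...]. *)
Lemma magnification_sum_zero_E7 (c1 c2 c3 c4 s1 s2 : R) :
  magnification_sum_zero (F_E7 c1 c2 c3 c4 s1 s2) 7.
Proof.
  apply (bezoutian_magnification_sum_zero 7 0 4 (-3) _
    (fun x y => 3 * x ^ 2 + y ^ 3 + c1 * y - s1)
    (fun x y => 3 * x * y ^ 2 + 4 * c4 * y ^ 3 + 3 * c3 * y ^ 2 + 2 * c2 * y + c1 * x - s2)
    (fun x y u v => 3 * (x + u))
    (fun x y u v => y ^ 2 + y * v + v ^ 2 + c1)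
    (fun x y u v => 3 * y ^ 2 + c1)
    (fun x y u v => 3 * u * (y + v) + 4 * c4 * (y ^ 2 + y * v + v ^ 2)
                    + 3 * c3 * (y + v) + 2 * c2)
    (fun b x y => nth b
      [3 * x * (4 * c4 * y ^ 2 + 3 * c3 * y + 2 * c2) + 3 * y * s1 + 4 * c4 * s2
         - (3 * y ^ 2 + c1) * (y ^ 2 + c1);
       3 * x * (4 * c4 * y + 3 * c3) - 3 * c1 * y + 3 * s1 - 8 * c4 * c2
         - (3 * y ^ 2 + c1) * y;
       12 * c4 * x - 3 * c1 - 12 * c4 * c3 - (3 * y ^ 2 + c1);
       - 3 * y - 16 * c4 ^ 2;
       -3;
       9 * x * y + 3 * (4 * c4 * y ^ 2 + 3 * c3 * y + 2 * c2) - 4 * c4 * c1;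
       9 * x + 3 * (4 * c4 * y + 3 * c3)] 0)
    (fun b u v => nth b [1; v; v ^ 2; v ^ 3; v ^ 4; u; u * v] 0));
    unfold F_E7; try solve_partial; try lia; try reflexivity.
  - intros; ring.
  - intros; ring.
  - intros x y u v E1 E2. unfold sumR. cbn [seq map fold_right nth].
    replace s1 with (3 * u ^ 2 + v ^ 3 + c1 * v) by lra.
    replace s2 with (3 * u * v ^ 2 + 4 * c4 * v ^ 3 + 3 * c3 * v ^ 2 + 2 * c2 * v
                     + c1 * u) by lra.
    ring.
  - lra.
Qed.

(** [u^2] and [u^2 v] are eliminated through the first partial derivative, and the
    resulting [v^4] through the second. *)
Lemma magnification_sum_zero_E8 (c1 c2 c3 c4 c5 s1 s2 : R) :
  magnification_sum_zero (F_E8 c1 c2 c3 c4 c5 s1 s2) 8.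
Proof.
  apply (bezoutian_magnification_sum_zero 8 0 7 15 _
    (fun x y => 3 * x ^ 2 + c5 * y ^ 3 + c4 * y ^ 2 + c1 * y - s1)
    (fun x y => 5 * y ^ 4 + 3 * c5 * x * y ^ 2 + 2 * c4 * x * y + 3 * c3 * y ^ 2
                + 2 * c2 * y + c1 * x - s2)
    (fun x y u v => 3 * (x + u))
    (fun x y u v => c5 * (y ^ 2 + y * v + v ^ 2) + c4 * (y + v) + c1)
    (fun x y u v => 3 * c5 * y ^ 2 + 2 * c4 * y + c1)
    (fun x y u v => 5 * (y ^ 3 + y ^ 2 * v + y * v ^ 2 + v ^ 3) + 3 * c5 * u * (y + v)
                    + 2 * c4 * u + 3 * c3 * (y + v) + 2 * c2)
    (fun b x y =>
      (* [A] is the lower left entry of the matrix; [T] and [D] are the part free of [u] and the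
         coefficient of [u] in the lower right entry at [v = 0]. Eliminating [u ^ 2 * v] produces
         [- 3 * c5 ^ 2 * v ^ 4], and solving the second equation for [v ^ 4] turns this into
         multiples of [q]. *)
      let A := 3 * c5 * y ^ 2 + 2 * c4 * y + c1 in
      let D := 3 * c5 * y + 2 * c4 in
      let T := 5 * y ^ 3 + 3 * c3 * y + 2 * c2 in
      let q := 3 * c5 ^ 2 / 5 in
      nth b
      [3 * x * T + D * s1 - q * s2 - A * (c5 * y ^ 2 + c4 * y + c1);
       3 * x * (5 * y ^ 2 + 3 * c3) - D * c1 + 3 * c5 * s1 + 2 * q * c2
         - A * (c5 * y + c4);
       15 * x * y - D * c4 - 3 * c5 * c1 + 3 * q * c3 - A * c5;
       15 * x - D * c5 - 3 * c5 * c4;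
       3 * x * D + 3 * T + q * c1;
       9 * c5 * x + 3 * (5 * y ^ 2 + 3 * c3) + 2 * q * c4;
       15 * y + 3 * q * c5;
       15] 0)
    (fun b u v => nth b [1; v; v ^ 2; v ^ 3; u; u * v; u * v ^ 2; u * v ^ 3] 0));
    unfold F_E8; try solve_partial; try lia; try reflexivity.
  - intros; ring.
  - intros; ring.
  - intros x y u v E1 E2. unfold sumR. cbn [seq map fold_right nth].
    replace s1 with (3 * u ^ 2 + c5 * v ^ 3 + c4 * v ^ 2 + c1 * v) by lra.
    replace s2 with (5 * v ^ 4 + 3 * c5 * u * v ^ 2 + 2 * c4 * u * v + 3 * c3 * v ^ 2
                     + 2 * c2 * v + c1 * u) by lra.
    field.
  - lra.
Qed.

(** * Polynomials in one variable and their divided differences *)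

Definition poly (a : nat -> R) (N : nat) (x : R) : R :=
  sumR 0 N (fun k => a k * x ^ k).

(** This is the quotient of [poly a (S N) x - poly a (S N) v] by [x - v], ordered by powers of [v]
    so that it already has the form of a sum of products [h_b(p) m_b(q)]. *)
Definition divided_diff (a : nat -> R) (N : nat) (x v : R) : R :=
  sumR 0 N (fun i => poly (fun j => a (S i + j)%nat) (N - i) x * v ^ i).

Lemma poly_horner (a : nat -> R) (N : nat) (x : R) :
  poly a (S N) x = a 0%nat + x * poly (fun k => a (S k)) N x.
Proof.
  unfold poly. rewrite sumR_recl, <- sumR_scal. f_equal; [simpl; ring|].
  apply sumR_ext; intros; simpl; ring.
Qed.

Lemma divided_diff_recl (a : nat -> R) (N : nat) (x v : R) :
  divided_diff a (S N) x v
  = poly (fun k => a (S k)) (S N) x + v * divided_diff (fun k => a (S k)) N x v.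
Proof.
  unfold divided_diff. rewrite sumR_recl, <- sumR_scal. f_equal; [simpl; ring|].
  apply sumR_ext; intros; simpl; ring.
Qed.

(** Induction along Horner's scheme, with [x * p(x) - v * p(v) = p(x) * (x - v) + v * (p(x) -
    p(v))]. *)
Lemma poly_diff (a : nat -> R) (N : nat) (x v : R) :
  poly a (S N) x - poly a (S N) v = divided_diff a N x v * (x - v).
Proof.
  revert a. induction N as [|N IH]; intros a.
  - unfold poly, divided_diff, sumR. simpl. ring.
  - rewrite divided_diff_recl, !(poly_horner a (S N)).
    specialize (IH (fun k => a (S k))).
    transitivity (poly (fun k => a (S k)) (S N) x * (x - v)
      + v * (poly (fun k => a (S k)) (S N) x - poly (fun k => a (S k)) (S N) v)); [ring|].
    rewrite IH. ring.
Qed.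

(** The product rule for [t * p(t)] matches [divided_diff_recl] at [v = x]. This form of the
    derivative is what the criterion requires on the diagonal. *)
Lemma is_derive_poly_divided_diff (a : nat -> R) (N : nat) (x : R) :
  is_derive (poly a (S N)) x (divided_diff a N x x).
Proof.
  revert a. induction N as [|N IH]; intros a.
  - apply (is_derive_ext (fun _ => a 0%nat));
      [intros; unfold poly, sumR; simpl; ring | apply (is_derive_const (V := R_NormedModule))].
  - rewrite divided_diff_recl.
    apply (is_derive_ext (fun t => a 0%nat + t * poly (fun k => a (S k)) (S N) t));
      [intros; now rewrite (poly_horner a (S N))|].
    specialize (IH (fun k => a (S k))).
    auto_derive; [now exists (divided_diff (fun k => a (S k)) N x x)|].
    apply is_derive_unique in IH.
    change (Derive (fun t => poly (fun k => a (S k)) (S N) t) x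
            = divided_diff (fun k => a (S k)) N x x) in IH.
    rewrite IH. ring.
Qed.

Lemma is_derive_poly (a : nat -> R) (N : nat) (x : R) :
  is_derive (poly a (S N)) x (poly (fun k => INR (S k) * a (S k)) N x).
Proof.
  induction N as [|N IH].
  - apply (is_derive_ext (fun _ => a 0%nat));
      [intros; unfold poly, sumR; simpl; ring | apply (is_derive_const (V := R_NormedModule))].
  - apply (is_derive_ext (fun t => poly a (S N) t + a (S N) * t ^ (S N)));
      [intros; unfold poly; now rewrite (sumR_recr _ (S N))|].
    replace (poly (fun k => INR (S k) * a (S k)) (S N) x)
      with (poly (fun k => INR (S k) * a (S k)) N x + a (S N) * (INR (S N) * x ^ N))
      by (unfold poly; rewrite (sumR_recr _ N); simpl; ring).
    apply (is_derive_plus (V := R_NormedModule)); [exact IH|].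
    auto_derive; [exact I|]. simpl. ring.
Qed.

(** * The families A and D *)

(** The variables separate, so the Bezoutian is [2 * sgn e2] times a divided difference in [x] and
    [u]. It is already expanded in the monomials [u ^ i] with [i < n], and no reduction modulo the
    gradient is needed. *)
Lemma magnification_sum_zero_A (n : nat) (e1 e2 e3 : bool) (c : nat -> R) (s1 s2 : R) :
  (2 <= n)%nat -> magnification_sum_zero (F_A n e1 e2 e3 c s1 s2) n.
Proof.
  intros Hn.
  (* Coefficients of the part in [x1]. The test [k < 3] precedes [k = n] so that for [n = 2] the
     quadratic coefficient is [s2]; for larger [n] the coefficient of degree [n] is 0. *)
  set (a := fun k => if Nat.eqb k (n + 1) then sgn e1
                     else if Nat.ltb k 3 then nth k [0; - s1; s2] 0
                     else if Nat.eqb k n then 0 else c k).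
  set (b := fun k => INR (S k) * a (S k)).
  assert (EF : forall x y, poly a (n + 2) x + (sgn e2 * y ^ 2 + sgn e3 * s2 * y)
                           = F_A n e1 e2 e3 c s1 s2 x y).
  { intros x y. unfold F_A, poly.
    (* For [n = 2] the truncated [n - 3] would break the splitting of the range used below. *)
    destruct (Nat.eq_dec n 2) as [->|Hn2]; [unfold sumR, a; simpl; ring|].
    replace (n + 2)%nat with (3 + S (S (n - 3)))%nat by lia.
    rewrite sumR_split, (sumR_recr (0 + 3) (S (n - 3))), (sumR_recr (0 + 3) (n - 3)).
    rewrite (sumR_ext (0 + 3) (n - 3) _ (fun k => c k * x ^ k)).
    2: { intros i Hi. unfold a. destruct (Nat.eqb_spec i (n + 1)); [lia|].
         destruct (Nat.ltb_spec i 3); [lia|].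
         destruct (Nat.eqb_spec i n); [lia|reflexivity]. }
    replace (0 + 3 + (n - 3))%nat with n by lia.
    replace (0 + 3 + S (n - 3))%nat with (n + 1)%nat by lia.
    replace (a n) with 0.
    2: { unfold a. destruct (Nat.eqb_spec n (n + 1)); [lia|].
         destruct (Nat.ltb_spec n 3); [lia|]. now rewrite Nat.eqb_refl. }
    replace (a (n + 1)%nat) with (sgn e1) by (unfold a; now rewrite Nat.eqb_refl).
    assert (Ha : forall k, (k < 3)%nat -> a k = nth k [0; - s1; s2] 0).
    { intros k Hk. unfold a. destruct (Nat.eqb_spec k (n + 1)); [lia|].
      now destruct (Nat.ltb_spec k 3); [|lia]. }
    unfold sumR at 1. cbn [seq map fold_right]. rewrite !Ha by lia. cbn [nth].
    change (0 + 3)%nat with 3%nat. ring. }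
  apply (bezoutian_magnification_sum_zero n 0 (n - 1)
    (2 * sgn e2 * (INR (n + 1) * sgn e1)) _
    (fun x y => poly b (S n) x)
    (fun x y => 2 * sgn e2 * y + sgn e3 * s2)
    (fun x y u v => divided_diff b n x u) (fun x y u v => 0)
    (fun x y u v => 0) (fun x y u v => 2 * sgn e2)
    (fun i x y => 2 * sgn e2 * poly (fun j => b (S i + j)%nat) (n - i) x)
    (fun i u v => u ^ i)); try lia; try (intros; simpl; ring).
  - intros x y. apply is_derive_Reals.
    apply (is_derive_ext (fun t => poly a (n + 2) t + (sgn e2 * y ^ 2 + sgn e3 * s2 * y)));
      [intros; apply EF|].
    replace (n + 2)%nat with (S (S n)) by lia.
    replace (poly b (S n) x) with (poly b (S n) x + 0) by ring.
    apply (is_derive_plus (V := R_NormedModule));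
      [apply is_derive_poly | apply (is_derive_const (V := R_NormedModule))].
  - intros x y. apply is_derive_Reals.
    apply (is_derive_ext (fun t => poly a (n + 2) x + (sgn e2 * t ^ 2 + sgn e3 * s2 * t)));
      [intros; apply EF|].
    auto_derive; [exact I|ring].
  - intros x y. apply is_derive_Reals, is_derive_poly_divided_diff.
  - solve_partial.
  - solve_partial.
  - solve_partial.
  - intros x y u v. rewrite poly_diff. ring.
  - intros x y u v _ _. unfold divided_diff.
    rewrite Rmult_0_l, Rminus_0_r, Rmult_comm, <- sumR_scal.
    apply sumR_ext; intros; ring.
  - intros x y. replace (n - (n - 1))%nat with 1%nat by lia.
    unfold poly, sumR. cbn [seq map fold_right].
    replace (S (n - 1) + 0)%nat with n by lia. unfold b, a.
    replace (S n) with (n + 1)%nat by lia. rewrite Nat.eqb_refl. simpl pow. ring.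
  - assert (0 < INR (n + 1)) by (apply lt_0_INR; lia).
    destruct e1, e2; simpl sgn; nra.
Qed.

(** The Bezoutian contains [-2u^2], where [u^2] equals minus the derivative of the
    [x2]-part of [F] at [v]: this supplies the top monomial [v^(n-2)]. *)
Lemma magnification_sum_zero_D (n : nat) (e : bool) (c : nat -> R) (s1 s2 : R) :
  (4 <= n)%nat -> magnification_sum_zero (F_D n e c s1 s2) n.
Proof.
  intros Hn.
  (* Writing [n = N + 3] removes truncated subtractions; the part in [x2] then has degree
     [N + 2]. *)
  destruct (Nat.le_exists_sub 3 n) as [N [-> _]]; [lia|].
  set (a := fun k => if Nat.eqb k (N + 2) then sgn e
                     else if Nat.ltb k 2 then nth k [0; - s2] 0 else c k).
  set (b := fun k => INR (S k) * a (S k)).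
  assert (EF : forall x y, poly a (S (S (S N))) y + (x ^ 2 * y - s1 * x)
                           = F_D (N + 3) e c s1 s2 x y).
  { intros x y. unfold F_D, poly.
    replace (N + 3 - 1)%nat with (N + 2)%nat by lia.
    replace (N + 3 - 3)%nat with N by lia.
    change (S (S (S N))) with (2 + S N)%nat.
    rewrite sumR_split, (sumR_recr (0 + 2) N).
    rewrite (sumR_ext (0 + 2) N _ (fun k => c k * y ^ k)).
    2: { intros i Hi. unfold a. destruct (Nat.eqb_spec i (N + 2)); [lia|].
         now destruct (Nat.ltb_spec i 2); [lia|]. }
    replace (0 + 2 + N)%nat with (N + 2)%nat by lia.
    replace (a (N + 2)%nat) with (sgn e) by (unfold a; now rewrite Nat.eqb_refl).
    assert (Ha : forall k, (k < 2)%nat -> a k = nth k [0; - s2] 0).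
    { intros k Hk. unfold a. destruct (Nat.eqb_spec k (N + 2)); [lia|].
      now destruct (Nat.ltb_spec k 2); [|lia]. }
    unfold sumR at 1. cbn [seq map fold_right]. rewrite !Ha by lia. cbn [nth].
    change (0 + 2)%nat with 2%nat. ring. }
  apply (bezoutian_magnification_sum_zero (N + 3) 0 (N + 1)
    (2 * (INR (N + 2) * sgn e)) _
    (fun x y => 2 * x * y - s1)
    (fun x y => x ^ 2 + poly b (S (S N)) y)
    (fun x y u v => 2 * y) (fun x y u v => 2 * u)
    (fun x y u v => x + u) (fun x y u v => divided_diff b (S N) y v)
    (* Index [N + 2] is the monomial [u], the others are [v ^ i]. The terms [2 * b i] come from
       [- 2 * u ^ 2], and [- 2 * x] from [- 2 * u * x]. *)
    (fun i x y => if Nat.eqb i (N + 2) then - 2 * x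
       else 2 * y * poly (fun j => b (S i + j)%nat) (S N - i) y + 2 * b i)
    (fun i u v => if Nat.eqb i (N + 2) then u else v ^ i));
    try lia; try (intros; ring).
  - intros x y. apply is_derive_Reals.
    apply (is_derive_ext (fun t => poly a (S (S (S N))) y + (t ^ 2 * y - s1 * t)));
      [intros; apply EF|].
    auto_derive; [exact I|ring].
  - intros x y. apply is_derive_Reals.
    apply (is_derive_ext (fun t => poly a (S (S (S N))) t + (x ^ 2 * t - s1 * x)));
      [intros; apply EF|].
    rewrite Rplus_comm.
    apply (is_derive_plus (V := R_NormedModule)); [apply is_derive_poly|].
    auto_derive; [exact I|ring].
  - solve_partial.
  - solve_partial.
  - solve_partial.
  - intros x y. apply is_derive_Reals.
    replace (divided_diff b (S N) y y) with (0 + divided_diff b (S N) y y) by ring.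
    apply (is_derive_plus (V := R_NormedModule));
      [apply (is_derive_const (V := R_NormedModule)) | apply is_derive_poly_divided_diff].
  - intros x y u v.
    transitivity (x ^ 2 - u ^ 2 + (poly b (S (S N)) y - poly b (S (S N)) v)); [ring|].
    rewrite poly_diff. ring.
  - intros x y u v _ E2.
    replace (N + 3)%nat with (S (S (S N))) by lia.
    rewrite sumR_recr. replace (0 + S (S N))%nat with (N + 2)%nat by lia.
    rewrite Nat.eqb_refl.
    rewrite (sumR_ext _ _ _ (fun i =>
      2 * y * (poly (fun j => b (S i + j)%nat) (S N - i) y * v ^ i) + 2 * (b i * v ^ i))).
    2: { intros i Hi. destruct (Nat.eqb_spec i (N + 2)); [lia|ring]. }
    rewrite sumR_plus, !sumR_scal.
    fold (poly b (S (S N)) v). replace (poly b (S (S N)) v) with (- u ^ 2) by lra.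
    (* The sum has one term more than [divided_diff b (S N)]; at [i = S N] the polynomial factor is
       empty, so that term is 0. *)
    rewrite (sumR_recr 0 (S N)).
    fold (divided_diff b (S N) y v).
    replace (S N - (0 + S N))%nat with 0%nat by lia.
    unfold poly at 1, sumR at 1. simpl. ring.
  - intros x y. destruct (Nat.eqb_spec 0 (N + 2)); [lia|reflexivity].
  - intros x y. destruct (Nat.eqb_spec (N + 1) (N + 2)); [lia|].
    replace (S N - (N + 1))%nat with 0%nat by lia.
    unfold poly, sumR at 1. cbn [seq map fold_right].
    unfold b, a. replace (S (N + 1)) with (N + 2)%nat by lia. rewrite Nat.eqb_refl. ring.
  - assert (0 < INR (N + 2)) by (apply lt_0_INR; lia).
    destruct e; simpl sgn; nra.
Qed.



Theorem theorem9p1 :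
  (forall (n : nat) (e1 e2 e3 : bool) (c : nat -> R) (s1 s2 : R),
      (2 <= n)%nat ->
      magnification_sum_zero (F_A n e1 e2 e3 c s1 s2) n) /\
  (forall (n : nat) (e : bool) (c : nat -> R) (s1 s2 : R),
      (4 <= n)%nat ->
      magnification_sum_zero (F_D n e c s1 s2) n) /\
  (forall (e : bool) (c1 c2 c3 s1 s2 : R),
      magnification_sum_zero (F_E6 e c1 c2 c3 s1 s2) 6) /\
  (forall (c1 c2 c3 c4 s1 s2 : R),
      magnification_sum_zero (F_E7 c1 c2 c3 c4 s1 s2) 7) /\
  (forall (c1 c2 c3 c4 c5 s1 s2 : R),
      magnification_sum_zero (F_E8 c1 c2 c3 c4 c5 s1 s2) 8).
Proof.
  repeat split; intros.
  - now apply magnification_sum_zero_A.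
  - now apply magnification_sum_zero_D.
  - apply magnification_sum_zero_E6.
  - apply magnification_sum_zero_E7.
  - apply magnification_sum_zero_E8.
Qed.
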